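(* Let $M$ be a Malcev algebra over $\mathbb{F}$, $E$ a vector space containing $M$ as a subspace, and $(E,[\,,\,])$ a Malcev algebra structure on $E$ such that $M$ is a Malcev subalgebra of $E$. Then there exist a subspace $V$ of $E$ that is a complement of $M$ in $E$, an extending structure $\Omega(M,V)=(\triangleleft,\triangleright,\omega,[\,,\,])$ of $M$ through $V$, and an isomorphism of Malcev algebras $(E,[\,,\,])\cong M\,\natural\,V$ that stabilizes $M$ and co-stabilizes $V$.
   Context: All algebras and vector spaces are over an algebraically closed field $\mathbb{F}$ of characteristic different from $2$ and $3$. A Malcev algebra is a vector space $M$ with a bilinear operation $[\,,\,]:M\times M\to M$ such that $[x,y]=-[y,x]$ and $J(x,y,[x,z])=[J(x,y,z),x]$ for all $x,y,z\in M$, where $J(x,y,z)=[[x,y],z]+[[y,z],x]+[[z,x],y]$. An extending datum of a Malcev algebra $M$ through a vector space $V$ is a system $\Omega(M,V)=(\triangleleft,\triangleright,\omega,[\,,\,])$ consisting of two bilinear maps $\triangleright:M\times V\to V$ and $\triangleleft:M\times V\to M$ and two skew-symmetric bilinear maps $[\,,\,]:V\times V\to V$ and $\omega:V\times V\to M$. $M\,\natural\,V$ denotes the vector space $M\oplus V$ with the bracket $$[(x,u),(y,v)]=\big([x,y]+x\triangleleft v-y\triangleleft u+\omega(u,v),\ x\triangleright v-y\triangleright u+[u,v]\big).$$ The extending datum is called an extending structure, and $M\,\natural\,V$ the associated unified product, if this bracket makes $M\oplus V$ a Malcev algebra. $M$ is embedded in $M\,\natural\,V$ by $x\mapsto(x,0)$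 and $M\,\natural\,V$ is projected onto $V$ by $(x,u)\mapsto u$; $E=M\oplus V$ has the inclusion $M\to E$ and the canonical projection $E\to V$. A linear map between $E$ and $M\,\natural\,V$ stabilizes $M$ if it commutes with the embeddings of $M$, and co-stabilizes $V$ if it commutes with the projections onto $V$. *)

(* Defs.v *)
From HB Require Import structures.
From mathcomp Require Import all_boot all_algebra.
From mathcomp Require Import boolp classical_sets.

Set Implicit Arguments.
Unset Strict Implicit.
Unset Printing Implicit Defensive.

Import GRing.Theory.
Local Open Scope ring_scope.

Section Malcev.
Variables (F : fieldType) (A : lmodType F).
Implicit Type br : A -> A -> A.

Definition jacobian br (x y z : A) : A :=
  br (br x y) z + br (br y z) x + br (br z x) y.

Definition is_malcev br : Prop :=
  [/\ bilinear_for *:%R *:%R br,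
      forall x y, br x y = - br y x
    & forall x y z, jacobian br x y (br x z) = br (jacobian br x y z) x].

End Malcev.

Definition malcev_iso (F : fieldType) (A B : lmodType F)
    (brA : A -> A -> A) (brB : B -> B -> B) (phi : {linear A -> B}) : Prop :=
  bijective phi /\ (forall x y, phi (brA x y) = brB (phi x) (phi y)).

(* A linear subspace S of E (a predicate), turned into a vector space of its
   own; the inclusion into E is [\val]. *)
Section Subspace.
Variables (F : fieldType) (E : lmodType F) (S : submodClosed E).

Record subspace_of := Subspace { subspace_val : E; _ : subspace_val \in S }.

HB.instance Definition _ := [isSub for subspace_val].
HB.instance Definition _ := [Choice of subspace_of by <:].
HB.instance Definition _ := [SubChoice_isSubLmodule of subspace_of by <:].

End Subspace.

Section Complement.
Variables (F : fieldType) (E : lmodType F) (M V : submodClosed E).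

Definition complement : Prop :=
  (forall x, x \in M -> x \in V -> x = 0) /\
  (forall x, exists m : subspace_of M, exists v : subspace_of V,
     x = \val m + \val v).

(* The canonical projection of E onto V along M; the default value 0 is never
   used when V is a complement of M. *)
Definition complement_proj (x : E) : subspace_of V :=
  xget (0 : subspace_of V)
    [set v | exists m : subspace_of M, x = \val m + \val v]%classic.

Lemma complement_projE (m : subspace_of M) (v : subspace_of V) :
  complement -> complement_proj (\val m + \val v) = v.
Proof.
case=> cap _; rewrite /complement_proj.
case: xgetP => [v' _ [m' e]|/(_ v) []]; last by exists m.
have dE : \val (v' - v) = \val (m - m').
  rewrite !raddfB /=; apply/eqP; rewrite subr_eq addrAC eq_sym subr_eq.
  by rewrite [eqbRHS]addrC; apply/eqP.
apply/eqP; rewrite -subr_eq0; apply/eqP/val_inj; rewrite raddf0.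
by apply: cap; [rewrite dE; exact: valP | exact: valP].
Qed.

End Complement.

(* [ed_lhd x v] is x <| v, [ed_rhd x v] is x |> v, [ed_br] is [ , ] on V. *)
Record extending_datum (F : fieldType) (M V : lmodType F) := ExtendingDatum {
  ed_lhd : {bilinear M -> V -> M};
  ed_rhd : {bilinear M -> V -> V};
  ed_omega : {bilinear V -> V -> M};
  ed_br : {bilinear V -> V -> V};
  ed_omega_skew : forall u v, ed_omega u v = - ed_omega v u;
  ed_br_skew : forall u v, ed_br u v = - ed_br v u }.

Section UnifiedProduct.
Variables (F : fieldType) (M V : lmodType F) (brM : M -> M -> M).
Variable Om : extending_datum M V.

Definition unified_bracket (p q : M * V) : M * V :=
  (brM p.1 q.1 + ed_lhd Om p.1 q.2 - ed_lhd Om q.1 p.2 + ed_omega Om p.2 q.2,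
   ed_rhd Om p.1 q.2 - ed_rhd Om q.1 p.2 + ed_br Om p.2 q.2).

Definition extending_structure : Prop := is_malcev unified_bracket.

End UnifiedProduct.

Section Stabilize.
Variables (F : fieldType) (E : lmodType F) (M V : submodClosed E).
Variable phi : {linear E -> (subspace_of M * subspace_of V)%type}.

Definition stabilizes : Prop := forall m : subspace_of M, phi (\val m) = (m, 0).

Definition co_stabilizes : Prop := forall x, (phi x).2 = complement_proj M V x.

End Stabilize.

(* Main.v *)
Require Import Defs.
From HB Require Import structures.
From mathcomp Require Import all_boot all_algebra.
From mathcomp Require Import boolp classical_sets.

Set Implicit Arguments.
Unset Strict Implicit.
Unset Printing Implicit Defensive.

Import GRing.Theory.
Local Open Scope ring_scope.

(* By Zorn's lemma M has a linear complement V in E.  Splitting the bracket of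
   E along E = M + V, i.e. letting x <| v, x |> v be the M- and V-components of
   [x, v] and omega(u, v), [u, v]_V those of [u, v], gives an extending datum,
   and x |-> (x_M, x_V) carries the bracket of E to the bracket of M # V, which
   is therefore a Malcev bracket. *)

(* The predicate to which Zorn's lemma is applied omits [0 \in A], so that it
   also holds for the union of the empty chain. *)
Lemma exists_complement {F : fieldType} {E : lmodType F} (M : submodClosed E) :
  exists V : submodClosed E, complement M V.
Proof.
pose P (A : set E) := (forall a u v, A u -> A v -> A (a *: u + v)) /\
  (forall x, x \in M -> A x -> x = 0).
have [C CP Ctot|A [[Alin AM] Amax]] := @Zorn_bigcup E P.
  split=> [a u v [X CX Xu] [Y CY Yv]|x Mx [X CX Xx]]; last first.
    by have [_ XM] := CP _ CX; apply: XM.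
  (* In a chain, the larger of [X] and [Y] contains both summands. *)
  have [XY|YX] := Ctot _ _ CX CY.
    by exists Y => //; have [Ylin _] := CP _ CY; apply: Ylin => //; apply: XY.
  by exists X => //; have [Xlin _] := CP _ CX; apply: Xlin => //; apply: YX.
(* If [0] were missing, adjoining it would give a strictly larger set satisfying [P]. *)
have A0 : A 0.
  apply: contrapT => nA0; apply: (Amax [set x | A x \/ x = 0]%classic).
    by split=> [x Ax|AA]; [left | apply/nA0/AA; right].
  split=> [a u v [Au|->] [Av|->]|x Mx [/(AM _ Mx)|]] //=.
  - by left; apply: Alin.
  - rewrite addr0; have [->|a0] := eqVneq a 0; first by right; rewrite scale0r.
    left; have -> : a *: u = (a - 1) *: u + u by rewrite scalerBl scale1r subrK.
    exact: Alin.
  - by left; rewrite scaler0 add0r.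
  - by right; rewrite scaler0 add0r.
have AZ a u : A u -> A (a *: u) by move=> Au; rewrite -[_ *: _]addr0; apply: Alin.
have Asub : submod_closed (fun x => `[< A x >]).
  split=> [|a u v /asboolP Au /asboolP Av]; first exact/asboolP.
  by apply/asboolP; apply: Alin.
pose V : submodClosed E := HB.pack_for (submodClosed E) (fun x => `[< A x >])
  (GRing.isSubmodClosed.Build F E (fun x => `[< A x >]) Asub).
have VE x : (x \in V) = `[< A x >] by [].
exists V; split=> [x Mx|x]; first by rewrite VE => /asboolP; apply: AM.
suff [m [v [Mm Av ->]]] : exists m v, [/\ m \in M, A v & x = m + v].
  have Vv : v \in V by rewrite VE; apply/asboolP.
  by exists (Subspace Mm), (Subspace Vv).
apply: contrapT => nx.
(* [B] is spanned by [x] and [A]. It is strictly larger than [A], since an [x] in [A] would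
   decompose as [0 + x]. *)
pose B := [set y | exists c v, A v /\ y = c *: x + v]%classic.
apply: (Amax B).
  split=> [v Av|BA]; first by exists 0, v; rewrite scale0r add0r.
  apply: nx; exists 0, x; rewrite rpred0 add0r; split => //.
  by apply: BA; exists 1, 0; rewrite scale1r addr0.
split=> [a _ _ [c [u [Au ->]]] [d [v [Av ->]]]|y My [c [v [Av yE]]]].
  exists (a * c + d), (a *: u + v); split; first exact: Alin.
  by rewrite scalerDr scalerA scalerDl addrACA.
have [c0|c0] := eqVneq c 0.
  by apply: AM => //; rewrite yE c0 scale0r add0r.
(* Solving [y = c *: x + v] for [x] gives the decomposition that [nx] excludes. *)
case: nx; exists (c^-1 *: y), (- c^-1 *: v); split.
- exact: rpredZ.
- exact: AZ.
- by rewrite yE scalerDr scalerA mulVf // scale1r scaleNr addrK.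
Qed.

(** Transport of structure: as [phi] is onto, every law required of [brB], bilinearity included, is
    the image of one for [brA]. This spares a componentwise check of the Malcev identity in the
    unified product. *)
Lemma malcev_iso_is_malcev {F : fieldType} {A B : lmodType F}
    {brA : A -> A -> A} {brB : B -> B -> B} {phi : {linear A -> B}} :
  malcev_iso brA brB phi -> is_malcev brA -> is_malcev brB.
Proof.
case=> [[psi phiK psiK]] phiM [[brAl brAr] skewA malcevA].
have phiJ x y z : phi (jacobian brA x y z) =
    jacobian brB (phi x) (phi y) (phi z).
  by rewrite /jacobian !linearD !phiM.
split; first split.
- move=> z a x y; rewrite -(psiK x) -(psiK y) -(psiK z).
  by rewrite -linearP -!phiM brAl linearP.
- move=> z a x y; rewrite -(psiK x) -(psiK y) -(psiK z).
  by rewrite -linearP -!phiM brAr linearP.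
- by move=> x y; rewrite -(psiK x) -(psiK y) -!phiM skewA linearN.
- move=> x y z; rewrite -(psiK x) -(psiK y) -(psiK z).
  by rewrite -phiM -!phiJ malcevA phiM.
Qed.

(** Exchanging the roles makes [complement_proj V M] available as the projection onto [M]. *)
Lemma complement_sym {F : fieldType} {E : lmodType F} {M V : submodClosed E} :
  complement M V -> complement V M.
Proof.
case=> MV0 MV; split=> [x Vx Mx|x]; first exact: MV0.
by have [m [v ->]] := MV x; exists v, m; rewrite addrC.
Qed.

(** Decompositions combine termwise into a decomposition, and by uniqueness it is the one that the
    choice picks. *)
Lemma complement_proj_linear {F : fieldType} {E : lmodType F}
    {M V : submodClosed E} :
  complement M V -> linear (complement_proj M V).
Proof.
move=> MV a x y; have [_ split_MV] := MV.
have [m [v ->]] := split_MV x; have [n [w ->]] := split_MV y.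
rewrite scalerDr addrACA -!linearZ -!linearD.
by rewrite !complement_projE.
Qed.

(** The linear structure depends on a proof of [complement M V], so the bundled map is supplied
    existentially. *)
Lemma complement_proj_linear_fun {F : fieldType} {E : lmodType F}
    {M V : submodClosed E} :
  complement M V ->
  exists pV : {linear E -> subspace_of V}, pV =1 complement_proj M V.
Proof.
move=> MV; pose isL := GRing.isLinear.Build F E (subspace_of V) *:%R
  (complement_proj M V) (complement_proj_linear MV).
by exists (HB.pack_for {linear E -> subspace_of V} (complement_proj M V) isL).
Qed.

Lemma complement_proj_split {F : fieldType} {E : lmodType F}
    {M V : submodClosed E} (x : E) :
  complement M V ->
  x = \val (complement_proj V M x) + \val (complement_proj M V x).
Proof.
move=> MV; have [_ /(_ x) [m [v ->]]] := MV.
rewrite (complement_projE _ _ MV) addrC (complement_projE _ _ (complement_sym MV)).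
exact: addrC.
Qed.

(** All four maps of the extending datum have this shape, with [f] a projection of [E] and [g], [h]
    inclusions into [E]. *)
Lemma bilinear_comp {F : fieldType} {E U V W : lmodType F} {br : E -> E -> E}
    (f : {linear E -> W}) (g : {linear U -> E}) (h : {linear V -> E}) :
  bilinear_for *:%R *:%R br ->
  bilinear_for *:%R *:%R (fun x y => f (br (g x) (h y))).
Proof.
by case=> brl brr; split=> z a x y; rewrite linearP ?brl ?brr linearP.
Qed.

Theorem theorem2p3 (F : closedFieldType)
    (char2 : 2%N \notin [pchar F]) (char3 : 3%N \notin [pchar F])
    (E : lmodType F) (M : submodClosed E)
    (brM : subspace_of M -> subspace_of M -> subspace_of M)
    (M_malcev : is_malcev brM)
    (brE : E -> E -> E) (E_malcev : is_malcev brE)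
    (M_subalgebra : forall x y : subspace_of M,
       brE (\val x) (\val y) = \val (brM x y)) :
  exists (V : submodClosed E)
         (Om : extending_datum (subspace_of M) (subspace_of V))
         (phi : {linear E -> (subspace_of M * subspace_of V)%type}),
    [/\ complement M V,
        extending_structure brM Om,
        malcev_iso brE (unified_bracket brM Om) phi,
        stabilizes phi
      & co_stabilizes phi].
Proof.
have [V MV] := exists_complement M.
have VM := complement_sym MV.
have [brE_bilin skewE _] := E_malcev; have [brEl brEr] := brE_bilin.
have [pM pME] := complement_proj_linear_fun VM.
have [pV pVE] := complement_proj_linear_fun MV.
have pMV x : \val (pM x) + \val (pV x) = x.
  by rewrite pME pVE -(complement_proj_split x MV).
have pM_E (m : subspace_of M) (v : subspace_of V) : pM (\val m + \val v) = m.
  by rewrite pME addrC complement_projE.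
have pV_E (m : subspace_of M) (v : subspace_of V) : pV (\val m + \val v) = v.
  by rewrite pVE complement_projE.
have pM_M (m : subspace_of M) : pM (\val m) = m.
  by rewrite -[RHS](pM_E m 0) raddf0 addr0.
have pV_M (m : subspace_of M) : pV (\val m) = 0.
  by rewrite -[RHS](pV_E m 0) raddf0 addr0.
pose iM : {linear subspace_of M -> E} := \val.
pose iV : {linear subspace_of V -> E} := \val.
pose bil (U1 U2 W : lmodType F) (f : {linear E -> W})
    (g : {linear U1 -> E}) (h : {linear U2 -> E}) : {bilinear U1 -> U2 -> W} :=
  HB.pack_for {bilinear U1 -> U2 -> W} (fun x y => f (brE (g x) (h y)))
    (bilinear_isBilinear.Build F U1 U2 W *:%R *:%R
       (fun x y => f (brE (g x) (h y))) (bilinear_comp f g h brE_bilin)).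
have omega_skew u v : bil _ _ _ pM iV iV u v = - bil _ _ _ pM iV iV v u.
  by rewrite /= skewE linearN.
have br_skew u v : bil _ _ _ pV iV iV u v = - bil _ _ _ pV iV iV v u.
  by rewrite /= skewE linearN.
(* The two maps on [V] are implicit here, read off from the types of [omega_skew] and [br_skew]. *)
pose Om := ExtendingDatum (bil _ _ _ pM iM iV) (bil _ _ _ pV iM iV)
  omega_skew br_skew.
have phi_linear : linear (fun x => (pM x, pV x)).
  by move=> a x y; rewrite !linearP.
pose phi : {linear E -> (subspace_of M * subspace_of V)%type} :=
  HB.pack_for {linear E -> (subspace_of M * subspace_of V)%type}
    (fun x => (pM x, pV x)) (GRing.isLinear.Build _ _ _ _ _ phi_linear).
have brDl x y z : brE (x + y) z = brE x z + brE y z.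
  by have := brEl z 1 x y; rewrite /= !scale1r.
have brDr x y z : brE z (x + y) = brE z x + brE z y.
  by have := brEr z 1 x y; rewrite /= !scale1r.
have phi_iso : malcev_iso brE (unified_bracket brM Om) phi.
  split.
    exists (fun p => \val p.1 + \val p.2) => [x|[m v]] /=; first exact: pMV.
    by rewrite pM_E pV_E.
  move=> x y; rewrite -[in LHS](pMV x) -[in LHS](pMV y).
  (* The term from [M] with [M] stays in [M], so its [V]-component vanishes; flipping the term from
     [V] with [M] produces the minus signs of the unified bracket. *)
  rewrite brDl !brDr M_subalgebra [brE (\val (pV x)) (\val (pM y))]skewE.
  rewrite /unified_bracket /= !linearD !linearN /= pM_M pV_M add0r.
  by rewrite !addrA.
(* Co-stabilization is [pVE], the second component of [phi] being [pV]. *)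
exists V, Om, phi; split=> //.
- exact: malcev_iso_is_malcev phi_iso E_malcev.
- by move=> m; rewrite /= pM_M pV_M.
Qed.
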